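(* Let $d=1$, $m>0$, $\gamma\in[0,1)$ and $f(x)=e^{-m|x|}|x|^{-\gamma}$, $x\in\mathbb{R}$. Then $$g_n(x)=\frac{\Gamma(1-\gamma)^n}{\Gamma((1-\gamma)n)}|x|^{(1-\gamma)(n-1)},\qquad x\in\mathbb{R},\ n\in\mathbb{N}.$$
   Context: $\mathbb{N}=\{1,2,\dots\}$; $f(0)=\infty$ if $\gamma>0$; $0^0=1$. The functions $g_n:\mathbb{R}\to[0,\infty)$ are defined by $g_1\equiv1$ and, for $n\in\mathbb{N}$, $$g_{n+1}(x):=\frac{\int_{E(x)}f(x-y)f(y)g_n(y)\,dy}{f(x)},\qquad E(x)=\{z\in\mathbb{R}:|z|<|x|,\ |x-z|<|x|\}.$$ An integral over the empty set equals $0$ and $a/(+\infty)=0$ for $a\ge0$. *)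

(* Defs.v *)
From HB Require Import structures.
From mathcomp Require Import all_boot all_order all_algebra.
From mathcomp Require Import all_classical all_reals all_analysis.

Set Implicit Arguments.
Unset Strict Implicit.
Unset Printing Implicit Defensive.

Import Order.TTheory GRing.Theory Num.Theory.
Import numFieldNormedType.Exports.

Local Open Scope classical_set_scope.
Local Open Scope ring_scope.

(* Euler's integral; it is finite exactly for 0 < s (for other s the value is
   the default of [fine] and has no meaning). *)
Definition Gamma (R : realType) (s : R) : R :=
  \int[@lebesgue_measure R]_(t in `]0, +oo[) (t `^ (s - 1) * expR (- t)).

(* [powR] gives 0 `^ a = 0 for a < 0, so the pole of f at the origin is written
   explicitly. For gamma = 0 the second branch applies at x = 0 and, since
   0 `^ 0 = 1, gives f 0 = 1. *)
Definition f (R : realType) (m gamma : R) (x : R) : \bar R :=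
  if (x == 0) && (0 < gamma) then +oo%E
  else (expR (- (m * `|x|)) * `|x| `^ (- gamma))%:E.

Definition E (R : realType) (x : R) : set R :=
  [set z | `|z| < `|x| /\ `|x - z| < `|x|].

(* [g_succ f k] is g_(k+1). Values are taken in \bar R, where a / +oo = 0 for
   every a >= 0. *)
Fixpoint g_succ (R : realType) (f : R -> \bar R) (k : nat) (x : R) : \bar R :=
  match k with
  | 0 => 1%E
  | k'.+1 =>
      ((\int[@lebesgue_measure R]_(y in E x)
          (f (x - y)%R * f y * g_succ f k' y)) / f x)%E
  end.

(* The sequence is indexed from 1; the index 0 carries no meaning. *)
Definition g (R : realType) (f : R -> \bar R) (n : nat) : R -> \bar R :=
  g_succ f n.-1.

(* Main.v *)
Require Import Defs.
From mathcomp Require Import all_boot all_order all_algebra.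
From mathcomp Require Import all_classical all_reals all_analysis.
From mathcomp Require Import measurable_realfun.
From mathcomp Require Import ring lra.

Set Implicit Arguments.
Unset Strict Implicit.
Unset Printing Implicit Defensive.

Import Order.TTheory GRing.Theory Num.Theory.
Import numFieldNormedType.Exports.

Local Open Scope classical_set_scope.
Local Open Scope ring_scope.

(** The substitution [y = x * t] turns the recursion into Euler's beta integral.
Put [a = 1 - gamma].  For [x != 0] the set [E x] is the open segment between
[0] and [x], on which [|x - y| + |y| = |x|].  The exponential factors of
[f (x - y)] and [f y] therefore multiply to the one of [f x] and cancel, and
if [g_(k+1) y] is a constant times [|y|^(a k)], then [g_(k+2) x] is that
constant times [|x|^gamma] times the integral over [E x] of
[|x - y|^(a - 1) |y|^(a (k + 1) - 1)].  By homogeneity this integral is a power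
of [|x|] times the beta function of [a] and [a (k + 1)], which is
[Gamma a * Gamma (a (k + 1)) / Gamma (a (k + 2))]: the factor
[Gamma (a (k + 1))] cancels against the constant in [g_(k+1)], so the
constants telescope.  At [x = 0] the set [E x] is empty and both sides vanish
except for the first function of the sequence.

The relation between beta and Gamma ([euler_integralM]) is proved for arbitrary
real exponents: writing [phi_s t = t^(s-1) exp (-t)] on the positive half-line,
the convolution of [phi_a] with [phi_b] is [phi_(a+b)] times the beta integral,
again because the exponentials combine, and Tonelli's theorem computes the total
mass of a convolution as the product of the masses.  This holds in the extended
reals without any integrability; dividing by [Gamma (a + b)] and reading the
result as real numbers requires that Euler's integral be positive and finite
([euler_integral_gt0], [euler_integral_lty]).  The two changes of variables,
translation and scaling, are both instances of [ge0_integral_affine]. *)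

(** * Affine change of variables for the Lebesgue integral *)

Lemma preimage_affine_pos (R : realType) (c d u v : R) : 0 < c ->
  (fun y => c * y + d) @^-1` `]u, v] = `](u - d) / c, (v - d) / c]%classic.
Proof.
move=> c0; apply/seteqP; split => y /=; rewrite !in_itv/= => /andP[h1 h2];
  apply/andP; move: h1 h2; rewrite ?ltr_pdivrMr ?ler_pdivlMr// => h1 h2;
  split; lra.
Qed.

Lemma preimage_affine_neg (R : realType) (c d u v : R) : c < 0 ->
  (fun y => c * y + d) @^-1` `]u, v] = `[(v - d) / c, (u - d) / c[%classic.
Proof.
move=> c0; apply/seteqP; split => y /=; rewrite !in_itv/= => /andP[h1 h2];
  apply/andP; move: h1 h2; rewrite ?ltr_ndivlMr ?ler_ndivrMr// => h1 h2;
  split; lra.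
Qed.

Lemma measurable_affine (R : realType) (c d : R) :
  measurable_fun [set: measurableTypeR R]
    (fun y => c * y + d : measurableTypeR R).
Proof. by apply: measurable_funD => //; exact: measurable_funM. Qed.

(** Both sides are measures in [A], so it suffices to compare them on half-open
intervals; these are mapped to intervals of length divided by [|c|], with the
closed end on the other side when [c] is negative. *)
Lemma lebesgue_measure_affine (R : realType) (c d : R) (A : set R) :
  c != 0 -> measurable A ->
  (`|c|%:E * lebesgue_measure ((fun y => c * y + d)%R @^-1` A) =
   lebesgue_measure A)%E.
Proof.
move=> c0 mA.
pose nu := mscale (NngNum (normr_ge0 c)) (pushforward (@lebesgue_measure R)
  (fun y => c * y + d : measurableTypeR R)).
have := @lebesgue_measure_unique R (nu (measurable_affine c d)).
move=> /(_ _ A mA) -> // _ [[u v] _ <-].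
change (lebesgue_measure `]u, v]%classic =
  (`|c|%:E * lebesgue_measure ((fun y : R => c * y + d)%R @^-1` `]u, v]))%E).
have [c_lt0|c_gt0] := orP (lt_total c0).
- rewrite preimage_affine_neg// !lebesgue_measure_itv/= !lte_fin.
  rewrite ltr_nM2r ?invr_lt0// ltrD2r ltr0_norm//.
  case: ifPn => _; last by rewrite mule0.
  by rewrite -!EFinD -EFinM; congr EFin; field; rewrite lt_eqF.
- rewrite preimage_affine_pos// !lebesgue_measure_itv/= !lte_fin.
  rewrite ltr_pM2r ?invr_gt0// ltrD2r gtr0_norm//.
  case: ifPn => _; last by rewrite mule0.
  by rewrite -!EFinD -EFinM; congr EFin; field.
Qed.

Lemma ge0_integral_affine (R : realType) (c d : R) (h : R -> \bar R) :
  c != 0 -> measurable_fun [set: R] h -> (forall y, 0 <= h y)%E ->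
  (\int[@lebesgue_measure R]_y h y =
   `|c|%:E * \int[@lebesgue_measure R]_y h (c * y + d)%R)%E.
Proof.
move=> c0 mh h0.
pose nu := mscale (NngNum (normr_ge0 c)) (pushforward (@lebesgue_measure R)
  (fun y => c * y + d : measurableTypeR R)).
transitivity (\int[nu (measurable_affine c d)]_y h y)%E.
  apply: eq_measure_integral => //= B mB _.
  by rewrite -(@lebesgue_measure_affine _ c d B).
rewrite ge0_integral_mscale//= ge0_integral_pushforward//.
exact: measurable_affine.
Qed.

(** * Euler's integral is positive and finite *)

(** Extended by zero to the whole line, so that integrals over the half-line and
over moving segments become integrals over [R] and translations act on them. *)
Definition euler_density (R : realType) (s : R) : R -> R :=
  (fun t => t `^ (s - 1) * expR (- t)) \_ `]0, +oo[.

(** [Gamma] before truncation to a real number: infinite values are kept. *)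
Definition euler_integral (R : realType) (s : R) : \bar R :=
  \int[@lebesgue_measure R]_t (euler_density s t)%:E.

Lemma euler_density_ge0 (R : realType) (s t : R) : 0 <= euler_density s t.
Proof.
by apply: restrict_ge0 => u _; rewrite mulr_ge0 ?powR_ge0 ?expR_ge0.
Qed.

Lemma euler_density_posE (R : realType) (s t : R) : 0 < t ->
  euler_density s t = t `^ (s - 1) * expR (- t).
Proof. by move=> t0; rewrite /euler_density patchE mem_set//= in_itv/= t0. Qed.

Lemma euler_density_nposE (R : realType) (s t : R) : t <= 0 ->
  euler_density s t = 0.
Proof.
move=> t0; rewrite /euler_density patchE memNset//= in_itv/= andbT.
by apply/negP; rewrite -leNgt.
Qed.

Lemma measurable_euler_density (R : realType) (s : R) :
  measurable_fun [set: R] (euler_density s).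
Proof.
apply/(measurable_restrictT _ _).1 => //; apply: measurable_funTS.
apply: measurable_funM; first exact: measurable_powR.
by apply: measurableT_comp => //; exact: measurable_expR.
Qed.

Lemma GammaE (R : realType) (s : R) : Gamma s = fine (euler_integral s).
Proof.
rewrite /Gamma /Rintegral integral_mkcond; congr fine.
by apply: eq_integral => t _; rewrite /euler_density restrict_EFin.
Qed.

(** The [p]-th power of [t <= p * exp (t / p)]. *)
Lemma powR_le_expR (R : realType) (p t : R) : 0 < p -> 0 <= t ->
  t `^ p <= p `^ p * expR t.
Proof.
move=> p0 t0.
have -> : p `^ p * expR t = (p * expR (t / p)) `^ p.
  rewrite powRM ?expR_ge0 ?(ltW p0)// -expRM divfK//.
  exact: lt0r_neq0.
apply: ge0_ler_powR; rewrite ?nnegrE ?mulr_ge0 ?expR_ge0 ?(ltW p0)//.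
rewrite mulrC -ler_pdivrMr//.
by apply: le_trans (expR_ge1Dx (t / p)); rewrite lerDr.
Qed.

(** A bounded function of [t > 0] whose derivative behaves like [t^(s-1)] near
[0]: it gives, with a single formula for all of the half-line, an integrable
majorant of the density, where the usual proof cuts the integral at [1]. *)
Definition majorant_primitive (R : realType) (s t : R) : R := - (1 + t `^ s)^-1.

Definition majorant (R : realType) (s t : R) : R :=
  s * t `^ (s - 1) * (1 + t `^ s) ^- 2.

Lemma addr1_powR_gt0 (R : realType) (s t : R) : 0 < 1 + t `^ s.
Proof. by rewrite ltr_pwDl ?powR_ge0. Qed.

Lemma is_derive1_addr1_powR (R : realType) (s t : R) : 0 < t ->
  is_derive t 1 (fun u => 1 + u `^ s) (s * t `^ (s - 1)).
Proof.
move=> t0; have D := is_derive1_powR s t0.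
by have := is_deriveD (is_derive_cst (1 : R) t 1) D; rewrite add0r.
Qed.

Lemma is_derive_kernel_primitive (R : realType) (s t : R) : 0 < t ->
  is_derive t 1 (majorant_primitive s) (majorant s t).
Proof.
move=> t0; have h := lt0r_neq0 (addr1_powR_gt0 s t).
have D := is_deriveN (@is_deriveV R (fun u => 1 + u `^ s) t _ _ h
  (is_derive1_addr1_powR s t0)).
have dE : - (- (1 + t `^ s) ^- 2 *: (s * t `^ (s - 1))) = majorant s t.
  by rewrite scaleNr opprK /majorant [RHS]mulrC.
rewrite -dE; exact: D.
Qed.

Lemma continuous_majorant (R : realType) (s t : R) : 0 < t ->
  {for t, continuous (majorant s)}.
Proof.
move=> t0; have h := lt0r_neq0 (addr1_powR_gt0 s t).
have powR_cvg p : u `^ p @[u --> t] --> t `^ p.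
  have D : derivable (fun u : R => u `^ p) t 1.
    by apply: derivable_powR; rewrite in_itv/= t0.
  by have /derivable1_diffP/differentiable_continuous := D.
rewrite /continuous_at /majorant; apply: cvgM.
  by apply: cvgM; [exact: cvg_cst|exact: powR_cvg].
under eq_fun do rewrite -exprVn expr2.
rewrite -exprVn expr2.
have D : (1 + u `^ s)^-1 @[u --> t] --> (1 + t `^ s)^-1.
  by apply: cvgV => //; apply: cvgD; [exact: cvg_cst|exact: powR_cvg].
exact: cvgM.
Qed.

Lemma kernel_primitive_cvgy (R : realType) (s : R) : 0 < s ->
  majorant_primitive s t @[t --> +oo] --> 0.
Proof.
move=> s0; apply/cvgr0Pnorm_lt => e e0; near=> t.
have et : e^-1 `^ s^-1 < t by near: t; exact: nbhs_pinfty_gt.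
have {}et : e^-1 < t `^ s.
  have := gt0_ltr_powR s0 _ _ et.
  rewrite -powRrM mulVf ?lt0r_neq0// powRr1 ?invr_ge0 ?(ltW e0)//.
  by apply; rewrite nnegrE ?powR_ge0// (le_trans (powR_ge0 _ _) (ltW et)).
rewrite normrN gtr0_norm ?invr_gt0 ?addr1_powR_gt0//.
rewrite invf_plt ?posrE ?addr1_powR_gt0//.
by rewrite (lt_trans et)// ltrDr.
Unshelve. all: by end_near. Qed.

(** The lower end stays away from [0], where the majorant need not be
continuous. *)
Lemma integral_majorant (R : realType) (s a : R) : 0 < s -> 0 < a ->
  (\int[@lebesgue_measure R]_(t in `[a, +oo[) (majorant s t)%:E =
   ((1 + a `^ s)^-1)%:E)%E.
Proof.
move=> s0 a0; have gt0 t : a <= t -> 0 < t by exact: lt_le_trans.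
rewrite (@ge0_continuous_FTC2y R (majorant s) (majorant_primitive s) a 0).
- by rewrite sub0e /majorant_primitive EFinN oppeK.
- move=> t _; rewrite !mulr_ge0 ?powR_ge0 ?invr_ge0 ?exprn_ge0 ?(ltW s0)//.
  exact/ltW/addr1_powR_gt0.
- apply: continuous_in_subspaceT => t; rewrite inE/= in_itv/= andbT => /gt0.
  exact: continuous_majorant.
- exact: kernel_primitive_cvgy.
- by move=> t /ltW/gt0 t0; have [] := is_derive_kernel_primitive s t0.
- apply: cvg_at_right_filter.
  have [D _] := is_derive_kernel_primitive s a0.
  by have /derivable1_diffP/differentiable_continuous := D.
- move=> t; rewrite in_itv/= andbT => /ltW/gt0 t0.
  by rewrite derive1E; have [_] := is_derive_kernel_primitive s t0.
Qed.

(** After cancelling [t^(s-1)] the claim is [(1 + t^s)^2 <= C exp t]; since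
[(1 + u)^2 <= 2 + 2 u^2], it follows from [powR_le_expR] with exponent [2 s],
which is where the constant comes from. *)
Lemma euler_density_le_majorant (R : realType) (s t : R) : 0 < s -> 0 < t ->
  euler_density s t <=
  (2 + 2 * (s *+ 2) `^ (s *+ 2)) / s * majorant s t.
Proof.
move=> s0 t0; rewrite euler_density_posE// /majorant.
set C := 2 + _; set u := t `^ s.
have u0 : 0 < 1 + u by exact: addr1_powR_gt0.
have -> : C / s * (s * t `^ (s - 1) * (1 + u) ^- 2) =
    t `^ (s - 1) * (C * (1 + u) ^- 2).
  by field; rewrite !lt0r_neq0.
rewrite ler_wpM2l ?powR_ge0// ler_pdivlMr ?exprn_gt0//.
rewrite expRN mulrC ler_pdivrMr ?expR_gt0//.
have uu : u ^+ 2 = t `^ (s *+ 2).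
  by rewrite -(powR_mulrn 2) ?powR_ge0// -powRrM mulr_natr.
have uE : u ^+ 2 <= (s *+ 2) `^ (s *+ 2) * expR t.
  by rewrite uu powR_le_expR ?(ltW t0)// mulrn_wgt0.
have E1 : 1 <= expR t by rewrite -expR0 ler_expR ltW.
have u1 := sqr_ge0 (1 - u).
rewrite /C; nra.
Qed.

(** The integrals over the half-lines starting at [1 / (n + 1)] are bounded by
[C], uniformly in [n], as the primitive of the majorant varies by at most [1]. *)
Lemma euler_integral_lty (R : realType) (s : R) : 0 < s ->
  (euler_integral s < +oo)%E.
Proof.
move=> s0; pose C := (2 + 2 * (s *+ 2) `^ (s *+ 2)) / s.
have C0 : 0 <= C by rewrite divr_ge0 ?(ltW s0)// addr_ge0// mulr_ge0// powR_ge0.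
have mE A : measurable_fun A (EFin \o euler_density s).
  apply/measurable_EFinP; apply: measurable_funTS.
  exact: measurable_euler_density.
pose A n : set R := `[n.+1%:R^-1, +oo[%classic.
have mA n : measurable (A n) by exact: measurable_itv.
have AE : \bigcup_n A n = `]0, +oo[%classic.
  apply/seteqP; split => t /=.
    move=> [n _]; rewrite /A/= !in_itv/= !andbT; apply: lt_le_trans.
    by rewrite invr_gt0.
  rewrite in_itv/= andbT => t0.
  exists (Num.truncn t^-1) => //; rewrite /A/= in_itv/= andbT.
  by rewrite invf_ple ?posrE// ltW// truncnS_gt.
have cvgA : (\int[@lebesgue_measure R]_(t in A n) (euler_density s t)%:E)%E
    @[n --> \oo] --> euler_integral s.
  have -> : euler_integral s = (\int[@lebesgue_measure R]_(t in \bigcup_n A n)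
      (euler_density s t)%:E)%E.
    rewrite AE /euler_integral [RHS]integral_mkcond; apply: eq_integral => t _.
    rewrite patchE; case: ifPn => // /negP; rewrite inE/= in_itv/= andbT => t0.
    by rewrite euler_density_nposE// leNgt; apply/negP.
  apply: ge0_nondecreasing_set_cvg_integral => //.
  - move=> m n mn; rewrite subsetEset; apply: subset_itvr.
    by rewrite bnd_simp lef_pV2 ?posrE// ler_nat.
  - by move=> n; exact: mE.
  - by move=> n t _; rewrite lee_fin euler_density_ge0.
suff : (euler_integral s <= C%:E)%E by move/le_lt_trans; apply; rewrite ltry.
move/cvg_lim : (cvgA) => <- //.
apply: lime_le; first by apply/cvg_ex; eexists; exact: cvgA.
apply: nearW => n.
have n0 : 0 < n.+1%:R^-1 :> R by rewrite invr_gt0.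
have mM : measurable_fun (A n) (EFin \o majorant s).
  apply/measurable_EFinP; apply: subspace_continuous_measurable_fun.
    exact: mA.
  apply: continuous_in_subspaceT => t; rewrite /A inE/= in_itv/= andbT => nt.
  by apply: continuous_majorant; exact: lt_le_trans nt.
have M0 t : 0 <= majorant s t.
  rewrite !mulr_ge0 ?powR_ge0 ?invr_ge0 ?exprn_ge0 ?(ltW s0)//.
  exact/ltW/addr1_powR_gt0.
apply: (@le_trans _ _ (\int[@lebesgue_measure R]_(t in A n)
    (C%:E * (majorant s t)%:E))%E).
  apply: ge0_le_integral => //.
  - exact: mA.
  - by move=> t _; rewrite lee_fin euler_density_ge0.
  - exact: mE.
  - exact: measurable_funeM.
  - move=> t; rewrite /A/= in_itv/= andbT => nt.
    rewrite -EFinM lee_fin euler_density_le_majorant//.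
    exact: lt_le_trans nt.
rewrite ge0_integralZl//; [|exact: mA|]; last by move=> t _; rewrite lee_fin.
rewrite integral_majorant// -EFinM lee_fin ler_piMr// invf_le1 ?addr1_powR_gt0//.
by rewrite lerDl powR_ge0.
Qed.

(** On [[1, 2]] the density is at least [exp (-2) / 2], because [t^(s-1)] is at
least [t^(-1)] for [t >= 1]. *)
Lemma euler_integral_gt0 (R : realType) (s : R) : 0 < s ->
  (0 < euler_integral s)%E.
Proof.
move=> s0; pose A : set R := `[1, 2]%classic.
have mE B : measurable_fun B (EFin \o euler_density s).
  apply/measurable_EFinP; apply: measurable_funTS.
  exact: measurable_euler_density.
apply: (@lt_le_trans _ _ (\int[@lebesgue_measure R]_(t in A)
    (cst (2^-1 * expR (-2))%:E) t)%E).
  rewrite integral_cst; last exact: measurable_itv.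
  apply: mule_gt0; first by rewrite lte_fin mulr_gt0 ?invr_gt0 ?expR_gt0.
  have : (0 < @lebesgue_measure R `[1%R, 2%R]%classic)%E; last by [].
  by rewrite lebesgue_measure_itv/= lte_fin ltr1n -EFinB lte_fin; lra.
apply: (@le_trans _ _ (\int[@lebesgue_measure R]_(t in A)
    (euler_density s t)%:E)%E); last first.
  apply: ge0_subset_integral => //; first exact: measurable_itv.
    exact: mE.
  by move=> t _; rewrite lee_fin euler_density_ge0.
apply: ge0_le_integral => //.
- exact: measurable_itv.
- by move=> t _; rewrite lee_fin mulr_ge0 ?expR_ge0// invr_ge0.
- exact: mE.
move=> t; rewrite /A/= in_itv/= => /andP[t1 t2].
have t0 : 0 < t by lra.
rewrite lee_fin euler_density_posE//; apply: ler_pM.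
- by rewrite invr_ge0.
- exact: expR_ge0.
- apply: (@le_trans _ _ t^-1); first by rewrite lef_pV2 ?posrE.
  by rewrite -powR_inv1 ?(ltW t0)//; apply: ler_powR => //; lra.
- by rewrite ler_expR lerN2.
Qed.

Lemma Gamma_gt0 (R : realType) (s : R) : 0 < s -> 0 < Gamma s.
Proof.
by move=> s0; rewrite GammaE fine_gt0// euler_integral_gt0// euler_integral_lty.
Qed.

Lemma GammaEFin (R : realType) (s : R) : 0 < s ->
  ((Gamma s)%:E = euler_integral s)%E.
Proof.
move=> s0; rewrite GammaE fineK// ge0_fin_numE ?euler_integral_lty//.
exact/ltW/euler_integral_gt0.
Qed.

(** * The beta integral over [E x] *)

(** Writing points of [E x] as [x * t] with [0 < t < 1] treats both signs of [x]
at once. *)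
Lemma mem_E_mul (R : realType) (x t : R) : x != 0 ->
  (x * t \in E x) = (0 < t < 1).
Proof.
move=> x0; have ax0 : 0 < `|x| by rewrite normr_gt0.
have -> : (x * t \in E x) = (`|x * t| < `|x|) && (`|x - x * t| < `|x|).
  by apply/idP/andP; rewrite inE.
rewrite -{3}(mulr1 x) -mulrBr !normrM !gtr_pMr// !ltr_norml.
by apply/idP/idP => [/andP[/andP[h1 h2] /andP[h3 h4]]|/andP[h1 h2]];
  rewrite ?ltrBlDr; lra.
Qed.

Lemma measurable_E (R : realType) (x : R) : measurable (E x).
Proof.
have -> : E x = ball 0 `|x| `&` ball x `|x|.
  by apply/seteqP; split => z; rewrite /ball/= sub0r normrN.
by apply: measurableI; exact: measurable_ball.
Qed.

(** At [x = 1] this is the beta function of [a] and [b]; the general case is the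
integral that occurs in the recursion. *)
Definition beta_integral (R : realType) (a b x : R) : \bar R :=
  \int[@lebesgue_measure R]_(y in E x)
    (`|x - y| `^ (a - 1) * `|y| `^ (b - 1))%:E.

Lemma measurable_beta_integrand (R : realType) (a b x : R) (D : set R) :
  measurable_fun D (fun y : R => (`|x - y| `^ (a - 1) * `|y| `^ (b - 1))%:E).
Proof.
have mnorm_powR p (h : R -> R) : measurable_fun [set: R] h ->
    measurable_fun [set: R] (fun y => `|h y| `^ p).
  move=> mh; have mn := measurableT_comp (@normr_measurable R setT) mh.
  exact: (measurableT_comp (measurable_powR p) mn).
apply: measurable_funTS; apply/measurable_EFinP; apply: measurable_funM.
  by apply: mnorm_powR; exact: measurable_funB.
exact: (mnorm_powR _ id).
Qed.

(** Homogeneity: under [y = x * t] each of the two powers and the Lebesgue measure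
contributes its own power of [|x|]. *)
Lemma beta_integral_scale (R : realType) (a b x : R) : x != 0 ->
  beta_integral a b x = ((`|x| `^ (a + b - 1))%:E * beta_integral a b 1)%E.
Proof.
move=> x0; have ax0 : 0 < `|x| by rewrite normr_gt0.
pose h z := (fun y : R => (`|z - y| `^ (a - 1) * `|y| `^ (b - 1))%:E) \_ (E z).
have h0 z y : (0 <= h z y)%E.
  by apply: erestrict_ge0 => u _; rewrite lee_fin mulr_ge0 ?powR_ge0.
have mh z : measurable_fun [set: R] (h z).
  apply/(measurable_restrictT _ _).1; first exact: measurable_E.
  exact: measurable_beta_integrand.
have mhx : measurable_fun [set: R] (fun t => h x (x * t + 0)).
  exact: (measurableT_comp (mh x) (measurable_affine x 0)).
have betaE z : beta_integral a b z = (\int[@lebesgue_measure R]_t h z t)%E.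
  by rewrite /beta_integral integral_mkcond.
rewrite !betaE (ge0_integral_affine 0 x0 (mh x) (h0 x)).
have hE t : (`|x|%:E * h x (x * t + 0)%R = (`|x| `^ (a + b - 1))%:E * h 1%R t)%E.
  rewrite addr0 /h !patchE mem_E_mul//.
  rewrite -[in RHS](mul1r t) mem_E_mul ?oner_eq0// mul1r.
  case: ifP => [/andP[t0 t1]|_]; last by rewrite !mule0.
  rewrite -!EFinM; congr EFin.
  rewrite -{2}(mulr1 x) -mulrBr !normrM !powRM//.
  have -> : a + b - 1 = 1 + ((a - 1) + (b - 1)) by ring.
  rewrite (powRD (r := 1)) ?(lt0r_neq0 ax0) ?implybT// powRr1//.
  rewrite (powRD (r := a - 1)) ?(lt0r_neq0 ax0) ?implybT//.
  by ring.
transitivity (\int[@lebesgue_measure R]_t (`|x|%:E * h x (x * t + 0)%R))%E.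
  by rewrite ge0_integralZl.
transitivity (\int[@lebesgue_measure R]_t ((`|x| `^ (a + b - 1))%:E * h 1%R t))%E.
  by apply: eq_integral => t _; exact: hE.
by rewrite ge0_integralZl//; exact: mh.
Qed.

(** For [x > 0] the integrand vanishes outside [E x], and on [E x] the
exponentials multiply to [exp (- x)], which leaves a beta integral.  For
[x <= 0] one of the arguments [y], [x - y] is never positive. *)
Lemma euler_density_convolution (R : realType) (a b x : R) :
  (\int[@lebesgue_measure R]_y (euler_density a (x - y) * euler_density b y)%:E =
   (euler_density (a + b) x)%:E * beta_integral a b 1)%E.
Proof.
have [x0|x0] := leP x 0.
  rewrite (euler_density_nposE _ x0) mul0e; apply: integral0_eq => y _.
  have [y0|y0] := leP y 0; first by rewrite (euler_density_nposE _ y0) mulr0.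
  by rewrite euler_density_nposE ?mul0r//; lra.
have -> : euler_density (a + b) x = expR (- x) * `|x| `^ (a + b - 1).
  by rewrite euler_density_posE// gtr0_norm// mulrC.
rewrite EFinM -muleA -beta_integral_scale ?lt0r_neq0//.
have h0 y : E x y -> (0 <= (`|x - y| `^ (a - 1) * `|y| `^ (b - 1))%:E)%E.
  by move=> _; rewrite lee_fin mulr_ge0 ?powR_ge0.
have expx0 : (0 <= (expR (- x))%:E)%E by rewrite lee_fin expR_ge0.
rewrite /beta_integral -(ge0_integralZl (@lebesgue_measure R) (measurable_E x)
  (@measurable_beta_integrand _ a b x _) h0 expx0).
rewrite [RHS]integral_mkcond; apply: eq_integral => y _.
have yE : y = x * (y / x) by rewrite mulrC divfK// lt0r_neq0.
rewrite patchE [in RHS]yE mem_E_mul ?lt0r_neq0// -yE.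
rewrite ltr_pdivrMr// mul1r pmulr_lgt0 ?invr_gt0//.
case: ifPn => [/andP[y0 yx]|].
  rewrite -EFinM euler_density_posE ?subr_gt0// euler_density_posE//.
  rewrite !gtr0_norm ?subr_gt0//; congr EFin.
  have -> : - x = - (x - y) + - y by ring.
  by rewrite expRD; ring.
rewrite negb_and -!leNgt => /orP[y0|xy].
  by rewrite (euler_density_nposE _ y0) mulr0.
by rewrite euler_density_nposE ?mul0r// subr_le0.
Qed.

(** The total mass of a convolution is the product of the masses.  No condition on
[a] and [b] is imposed, since Tonelli's theorem allows infinite values. *)
Lemma euler_integralM (R : realType) (a b : R) :
  (euler_integral a * euler_integral b =
   euler_integral (a + b) * beta_integral a b 1)%E.
Proof.
have phi0 (s t : R) : (0 <= (euler_density s t)%:E)%E.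
  by rewrite lee_fin euler_density_ge0.
have mphi (s : R) : measurable_fun [set: R] (fun t => (euler_density s t)%:E).
  by apply/measurable_EFinP; exact: measurable_euler_density.
have beta0 : (0 <= beta_integral a b 1)%E.
  by apply: integral_ge0 => y _; rewrite lee_fin mulr_ge0 ?powR_ge0.
rewrite [RHS]muleC /euler_integral -(ge0_integralZl (@lebesgue_measure R)
  measurableT (mphi (a + b)) (fun t _ => phi0 (a + b) t) beta0).
transitivity (\int[@lebesgue_measure R]_x \int[@lebesgue_measure R]_y
  (euler_density a (x - y) * euler_density b y)%:E)%E; last first.
  by apply: eq_integral => x _; rewrite euler_density_convolution muleC.
have mh : measurable_fun [set: R * R] (fun p : R * R =>
    (euler_density a (p.1 - p.2) * euler_density b p.2)%:E).
  apply/measurable_EFinP; apply: measurable_funM.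
    apply: (measurableT_comp (measurable_euler_density a)).
    by apply: measurable_funB.
  exact: (measurableT_comp (measurable_euler_density b)).
have tonelli := @fubini_tonelli _ _ _ _ R (@lebesgue_measure R)
  (@lebesgue_measure R) _ mh.
rewrite [RHS]tonelli/=; last first.
  by move=> p; rewrite lee_fin mulr_ge0 ?euler_density_ge0.
have intE (s : R) : (0 <= \int[@lebesgue_measure R]_t (euler_density s t)%:E)%E.
  exact: integral_ge0.
rewrite -(ge0_integralZl (@lebesgue_measure R) measurableT (mphi b)
  (fun t _ => phi0 b t) (intE a)).
apply: eq_integral => y _.
rewrite (ge0_integral_affine (- y) (oner_neq0 R) (mphi a) (phi0 a)) normr1 mul1e.
have mphiy : measurable_fun [set: R] (fun x => (euler_density a (1 * x - y))%:E).
  exact: (measurableT_comp (mphi a) (measurable_affine 1 (- y))).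
rewrite muleC -(ge0_integralZl (@lebesgue_measure R) measurableT mphiy
  (fun x _ => phi0 a (1 * x - y)) (phi0 b y)).
by apply: eq_integral => x _; rewrite mul1r -EFinM mulrC.
Qed.

(** As [Gamma (a + b)] is positive, the beta integral cannot be infinite: its
product with [Gamma (a + b)] is the finite [Gamma a * Gamma b]. *)
Lemma beta_integralE (R : realType) (a b x : R) : 0 < a -> 0 < b -> x != 0 ->
  beta_integral a b x =
  (`|x| `^ (a + b - 1) * (Gamma a * Gamma b / Gamma (a + b)))%:E.
Proof.
move=> a0 b0 x0; rewrite beta_integral_scale// EFinM; congr (_ * _)%E.
have ab0 : 0 < a + b by exact: addr_gt0.
have := euler_integralM a b; rewrite -!GammaEFin// -EFinM.
have := Gamma_gt0 ab0; move: (beta_integral a b 1) => [r| |] G0.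
- by rewrite -EFinM => -[->]; rewrite mulrC mulKf// lt0r_neq0.
- by rewrite gt0_muley ?lte_fin.
- by rewrite gt0_muleNy ?lte_fin.
Qed.

(** * The closed form of the recursion *)

(** [E x] lies between [0] and [x]; this makes the exponential factors
cancel. *)
Lemma normD_E (R : realType) (x y : R) : E x y -> `|x - y| + `|y| = `|x|.
Proof.
have [->|x0] := eqVneq x 0; first by case; rewrite normr0 normr_lt0.
have [t ->] : exists t, y = x * t by exists (y / x); rewrite mulrC divfK.
move/mem_set; rewrite mem_E_mul// => /andP[t0 t1].
rewrite -{1}(mulr1 x) -mulrBr !normrM (gtr0_norm t0).
rewrite (@gtr0_norm _ (1 - t)) ?subr_gt0//.
by ring.
Qed.

Lemma f_off_origin (R : realType) (m gamma x : R) : x != 0 ->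
  f m gamma x = (expR (- (m * `|x|)) * `|x| `^ (- gamma))%:E.
Proof. by rewrite /f => /negPf ->. Qed.

Lemma g_succ_closed_form (R : realType) (m gamma : R) (k : nat) (x : R) :
  gamma < 1 ->
  g_succ (f m gamma) k x =
    (Gamma (1 - gamma) ^+ k.+1 / Gamma ((1 - gamma) * k.+1%:R)
      * `|x| `^ ((1 - gamma) * k%:R))%:E.
Proof.
move=> gamma1; set a := 1 - gamma.
have a0 : 0 < a by rewrite subr_gt0.
have Ga := lt0r_neq0 (Gamma_gt0 a0).
elim: k x => [x|k IHk x] /=.
  by rewrite !mulr1 mulr0 powRr0 expr1 mulfV// mulr1.
have [->|x0] := eqVneq x 0.
  rewrite (_ : E 0 = set0) ?integral_set0 ?mul0e; last first.
    by apply/seteqP; split => // z []; rewrite normr0 normr_lt0.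
  by rewrite normr0 powR0 ?mulr0// mulf_neq0 ?lt0r_neq0.
have ax0 : 0 < `|x| by rewrite normr_gt0.
set b := a * k.+1%:R in IHk *.
have b0 : 0 < b by rewrite mulr_gt0.
(* the factors that do not depend on the integration variable *)
pose c := expR (- (m * `|x|)) * (Gamma a ^+ k.+1 / Gamma b).
have c0 : 0 <= c.
  by rewrite mulr_ge0 ?expR_ge0// divr_ge0 ?exprn_ge0// ltW// Gamma_gt0.
have intE : (\int[@lebesgue_measure R]_(y in E x)
    (f m gamma (x - y)%R * f m gamma y * g_succ (f m gamma) k y) =
    c%:E * beta_integral a b x)%E.
  have h0 y : E x y -> (0 <= (`|x - y| `^ (a - 1) * `|y| `^ (b - 1))%:E)%E.
    by move=> _; rewrite lee_fin mulr_ge0 ?powR_ge0.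
  have cE0 : (0 <= c%:E)%E by rewrite lee_fin.
  rewrite /beta_integral -(ge0_integralZl (@lebesgue_measure R)
    (measurable_E x) (@measurable_beta_integrand _ a b x _) h0 cE0).
  apply: eq_integral => y /set_mem Exy; have [yx xyx] := Exy.
  have y0 : y != 0 by apply: contraTneq xyx => ->; rewrite subr0 ltxx.
  have xy0 : x - y != 0.
    by rewrite subr_eq0; apply: contraTneq yx => ->; rewrite ltxx.
  rewrite IHk !f_off_origin// -!EFinM; congr EFin; rewrite /c -(normD_E Exy).
  have -> : b - 1 = - gamma + a * k%:R.
    by rewrite /b -natr1 mulrDr mulr1 /a; ring.
  rewrite (powRD (r := - gamma) (s := a * k%:R)) ?normr_eq0 ?y0 ?implybT//.
  rewrite (_ : a - 1 = - gamma); last first.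
    by rewrite /a; ring.
  by rewrite mulrDr opprD expRD; ring.
rewrite intE beta_integralE// f_off_origin// inver.
have fx0 : expR (- (m * `|x|)) * `|x| `^ (- gamma) != 0.
  by rewrite mulf_neq0 ?lt0r_neq0 ?expR_gt0 ?powR_gt0.
rewrite (negPf fx0) -!EFinM; congr EFin.
have -> : a * k.+2%:R = a + b by rewrite -natr1 mulrDr mulr1 addrC.
have -> : a + b - 1 = - gamma + b by rewrite /a; ring.
rewrite (powRD (r := - gamma) (s := b)) ?normr_eq0 ?x0 ?implybT// /c !exprS.
have := lt0r_neq0 (Gamma_gt0 b0); have := lt0r_neq0 (Gamma_gt0 (addr_gt0 a0 b0)).
have := lt0r_neq0 (expR_gt0 (- (m * `|x|))).
have := lt0r_neq0 (powR_gt0 (- gamma) ax0).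
move: (expR _) (Gamma b) (Gamma (a + b)) (`|x| `^ (- gamma)) (Gamma a ^+ _).
move=> e1 Gb Gab xg Gak h1 h2 h3 h4.
by field; rewrite h1 h2 h3 h4.
Qed.

Unset Implicit Arguments.

Theorem lemma4p2 (R : realType) (m gamma : R)
    (hm : 0 < m) (hgamma0 : 0 <= gamma) (hgamma1 : gamma < 1)
    (n : nat) (hn : (0 < n)%N) (x : R) :
  g (f m gamma) n x =
    (Gamma (1 - gamma) ^+ n / Gamma ((1 - gamma) * n%:R)
      * `|x| `^ ((1 - gamma) * (n%:R - 1)))%:E.
Proof.
case: n hn => // k _.
have -> : k.+1%:R - 1 = k%:R :> R by rewrite -natr1 addrK.
exact: g_succ_closed_form.
Qed.
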